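(* The category $\mathsf{hIL}$ of h-lattices (with algebra homomorphisms as morphisms) is equivalent to the full subcategory of $\mathsf{KhIL}^{c}$ whose objects satisfy condition (CK): for all $x,y\in T$, if $x\ge\mathsf{c}$, $y\ge\mathsf{c}$ and $x\wedge y\le\mathsf{c}$, then there exists $z\in T$ such that $z\vee\mathsf{c}=x$ and $\sim z\vee\mathsf{c}=y$.
   Context: A Kleene algebra is a bounded distributive lattice $\langle T,\wedge,\vee,0,1\rangle$ with a unary operation $\sim$ such that $\sim\sim x=x$, $\sim(x\wedge y)=\sim x\vee\sim y$ and $(x\wedge\sim x)\wedge(y\vee\sim y)=x\wedge\sim x$. A hemi-Nelson algebra is an algebra $\langle T,\wedge,\vee,\rightarrow,\sim,0,1\rangle$ of type $(2,2,2,1,0,0)$ such that $\langle T,\wedge,\vee,\sim,0,1\rangle$ is a Kleene algebra and for all $x,y,z\in T$: (hN1) $x\rightarrow x=1$; (hN2) $x\wedge(x\rightarrow y)\le x\wedge(\sim x\vee y)$; (hN3) $\sim(x\rightarrow y)\rightarrow(x\wedge\sim y)=1$; (hN4) $(x\wedge\sim y)\rightarrow\sim(x\rightarrow y)=1$; (hN5) $(x\wedge y\wedge(x\rightarrow y))\rightarrow(x\wedge(x\rightarrow y))=1$; (hN6) $(x\wedge(x\rightarrow y))\rightarrow(x\wedge y\wedge(x\rightarrow y))=1$; (hN7) if $x\rightarrow y=1$, $y\rightarrow x=1$, $y\rightarrow z=1$ and $z\rightarrow y=1$ then $x\rightarrow z=1$ and $z\rightarrow x=1$; (hN8) if $x\rightarrow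 y=1$ and $y\rightarrow x=1$ then $(x\wedge z)\rightarrow(y\wedge z)=1$; (hN9) if $x\rightarrow y=1$ and $y\rightarrow x=1$ then $(x\vee z)\rightarrow(y\vee z)=1$; (hN10) if $x\rightarrow y=1$ and $y\rightarrow x=1$ then $(x\rightarrow z)\rightarrow(y\rightarrow z)=1$ and $(z\rightarrow x)\rightarrow(z\rightarrow y)=1$. A centered hemi-Nelson algebra is an algebra $\langle T,\wedge,\vee,\rightarrow,\sim,0,1,\mathsf{c}\rangle$ where $\langle T,\wedge,\vee,\rightarrow,\sim,0,1\rangle$ is a hemi-Nelson algebra and $\mathsf{c}$ is a constant with $\sim\mathsf{c}=\mathsf{c}$; $\mathsf{KhIL}^{c}$ denotes the category of centered hemi-Nelson algebras with algebra homomorphisms (of this signature) as morphisms. An h-lattice is an algebra $\langle A,\wedge,\vee,\rightarrow,0,1\rangle$ of type $(2,2,2,0,0)$ such that $\langle A,\wedge,\vee,0,1\rangle$ is a bounded distributive lattice, $a\rightarrow a=1$ and $a\wedge(a\rightarrow b)\le b$ for all $a,b$. *)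

(* Defs.v *)
From HB Require Import structures.
From mathcomp Require Import all_boot all_order.
From mathcomp Require Import boolp.

Set Implicit Arguments.
Unset Strict Implicit.
Unset Printing Implicit Defensive.

Import Order.TTheory.
Local Open Scope order_scope.

Record category := Category {
  obj :> Type;
  hom : obj -> obj -> Type;
  idm : forall a, hom a a;
  compm : forall a b c, hom b c -> hom a b -> hom a c;
  compA : forall a b c d (h : hom c d) (g : hom b c) (f : hom a b),
    compm h (compm g f) = compm (compm h g) f;
  comp1m : forall a b (f : hom a b), compm (idm b) f = f;
  compm1 : forall a b (f : hom a b), compm f (idm a) = f
}.

Arguments hom {_} _ _.
Arguments idm {_} _.
Arguments compm {_ _ _ _} _ _.

Record functor (C D : category) := Functor {
  fobj :> C -> D;
  fmap : forall a b, hom a b -> hom (fobj a) (fobj b);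
  fmap1 : forall a, fmap (idm a) = idm (fobj a);
  fmapM : forall a b c (g : hom b c) (f : hom a b),
    fmap (compm g f) = compm (fmap g) (fmap f)
}.

Arguments fmap {C D} f {a b} _ : rename.

Definition functor_id (C : category) : functor C C :=
  @Functor C C id (fun _ _ f => f) (fun _ => erefl) (fun _ _ _ _ _ => erefl).

Section FunctorComp.
Variables (C D E : category) (G : functor D E) (F : functor C D).

Let fmapGF a b (f : @hom C a b) : hom (G (F a)) (G (F b)) := fmap G (fmap F f).

Let fmapGF1 a : fmapGF (idm a) = idm (G (F a)).
Proof. by rewrite /fmapGF !fmap1. Qed.

Let fmapGFM a b c (g : hom b c) (f : @hom C a b) :
  fmapGF (compm g f) = compm (fmapGF g) (fmapGF f).
Proof. by rewrite /fmapGF !fmapM. Qed.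

Definition functor_comp : functor C E := Functor fmapGF1 fmapGFM.

End FunctorComp.

Record natural_iso (C D : category) (F G : functor C D) := NaturalIso {
  niso : forall a, hom (F a) (G a);
  niso_inv : forall a, hom (G a) (F a);
  nisoK : forall a, compm (niso_inv a) (niso a) = idm (F a);
  niso_invK : forall a, compm (niso a) (niso_inv a) = idm (G a);
  niso_natural : forall a b (f : hom a b),
    compm (niso b) (fmap F f) = compm (fmap G f) (niso a)
}.

Definition equivalent_categories (C D : category) : Prop :=
  exists (F : functor C D) (G : functor D C),
    inhabited (natural_iso (functor_comp G F) (functor_id C)) /\
    inhabited (natural_iso (functor_comp F G) (functor_id D)).

Definition full_subcategory (C : category) (P : C -> Prop) : category :=
  @Category {a : C | P a} (fun a b => hom (sval a) (sval b))
    (fun a => idm (sval a)) (fun _ _ _ g f => compm g f)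
    (fun _ _ _ _ h g f => compA h g f)
    (fun _ _ f => comp1m f) (fun _ _ f => compm1 f).

(* Bounded distributive lattices are MathComp's tbDistrLatticeType: the trivial
   algebra is allowed, the display d is only a notation tag, and the choiceType
   on the carrier is ignored by the homomorphisms below. *)
HB.mixin Record hasImp (d : Order.disp_t) T of Order.TBDistrLattice d T := {
  imp : T -> T -> T
}.

#[short(type="impLatticeType")]
HB.structure Definition ImpLattice (d : Order.disp_t) :=
  { T of Order.TBDistrLattice d T & hasImp d T }.

Notation "x `-> y" := (imp x y) (at level 53, right associativity).

HB.mixin Record ImpLattice_isHLattice (d : Order.disp_t) T
    of ImpLattice d T := {
  hlat_impxx : forall a : T, a `-> a = \top;
  hlat_meet_imp : forall a b : T, a `&` (a `-> b) <= b
}.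

#[short(type="hLatticeType")]
HB.structure Definition HLattice (d : Order.disp_t) :=
  { T of ImpLattice d T & ImpLattice_isHLattice d T }.

HB.mixin Record TBDistrLattice_isKleene (d : Order.disp_t) T
    of Order.TBDistrLattice d T := {
  sneg : T -> T;
  snegK : forall x, sneg (sneg x) = x;
  sneg_meet : forall x y, sneg (x `&` y) = sneg x `|` sneg y;
  kleene_law : forall x y,
    (x `&` sneg x) `&` (y `|` sneg y) = x `&` sneg x
}.

#[short(type="kleeneAlgType")]
HB.structure Definition KleeneAlg (d : Order.disp_t) :=
  { T of Order.TBDistrLattice d T & TBDistrLattice_isKleene d T }.

HB.mixin Record KleeneAlg_isHemiNelson (d : Order.disp_t) T
    of KleeneAlg d T & ImpLattice d T := {
  hN1 : forall x : T, x `-> x = \top;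
  hN2 : forall x y : T, x `&` (x `-> y) <= x `&` (sneg x `|` y);
  hN3 : forall x y : T, sneg (x `-> y) `-> (x `&` sneg y) = \top;
  hN4 : forall x y : T, (x `&` sneg y) `-> sneg (x `-> y) = \top;
  hN5 : forall x y : T,
    (x `&` y `&` (x `-> y)) `-> (x `&` (x `-> y)) = \top;
  hN6 : forall x y : T,
    (x `&` (x `-> y)) `-> (x `&` y `&` (x `-> y)) = \top;
  hN7 : forall x y z : T,
    x `-> y = \top -> y `-> x = \top -> y `-> z = \top -> z `-> y = \top ->
    x `-> z = \top /\ z `-> x = \top;
  hN8 : forall x y z : T, x `-> y = \top -> y `-> x = \top ->
    (x `&` z) `-> (y `&` z) = \top;
  hN9 : forall x y z : T, x `-> y = \top -> y `-> x = \top ->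
    (x `|` z) `-> (y `|` z) = \top;
  hN10 : forall x y z : T, x `-> y = \top -> y `-> x = \top ->
    (x `-> z) `-> (y `-> z) = \top /\ (z `-> x) `-> (z `-> y) = \top
}.

#[short(type="hemiNelsonType")]
HB.structure Definition HemiNelson (d : Order.disp_t) :=
  { T of KleeneAlg d T & ImpLattice d T & KleeneAlg_isHemiNelson d T }.

HB.mixin Record HemiNelson_isCentered (d : Order.disp_t) T
    of HemiNelson d T := {
  center : T;
  sneg_center : sneg center = center
}.

#[short(type="centeredHemiNelsonType")]
HB.structure Definition CenteredHemiNelson (d : Order.disp_t) :=
  { T of HemiNelson d T & HemiNelson_isCentered d T }.

Arguments center {d s}.

Definition CK (d : Order.disp_t) (T : centeredHemiNelsonType d) : Prop :=
  forall x y : T, center <= x -> center <= y -> x `&` y <= center ->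
    exists z : T, z `|` center = x /\ sneg z `|` center = y.

Definition is_imp_lattice_hom (d : Order.disp_t) (A B : impLatticeType d)
    (f : A -> B) : Prop :=
  [/\ {morph f : x y / x `&` y}, {morph f : x y / x `|` y},
      {morph f : x y / x `-> y}, f \bot = \bot & f \top = \top].

Definition is_centered_hemi_nelson_hom (d : Order.disp_t)
    (S T : centeredHemiNelsonType d) (f : S -> T) : Prop :=
  [/\ is_imp_lattice_hom f, {morph f : x / sneg x} & f center = center].

Definition hlattice_hom (d : Order.disp_t) (A B : hLatticeType d) :=
  {f : A -> B | is_imp_lattice_hom f}.

Definition centered_hemi_nelson_hom (d : Order.disp_t)
    (S T : centeredHemiNelsonType d) :=
  {f : S -> T | is_centered_hemi_nelson_hom f}.

Lemma is_imp_lattice_hom_id (d : Order.disp_t) (A : impLatticeType d) :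
  is_imp_lattice_hom (fun x : A => x).
Proof. by []. Qed.

Lemma is_imp_lattice_hom_comp (d : Order.disp_t) (A B C : impLatticeType d)
    (g : B -> C) (f : A -> B) :
  is_imp_lattice_hom g -> is_imp_lattice_hom f ->
  is_imp_lattice_hom (fun x => g (f x)).
Proof.
move=> [gI gU gi g0 g1] [fI fU fi f0 f1].
by split=> [x y|x y|x y||]; rewrite ?fI ?fU ?fi ?f0 ?f1 ?gI ?gU ?gi.
Qed.

Lemma is_centered_hemi_nelson_hom_id (d : Order.disp_t)
    (T : centeredHemiNelsonType d) :
  is_centered_hemi_nelson_hom (fun x : T => x).
Proof. by split; first exact: is_imp_lattice_hom_id. Qed.

Lemma is_centered_hemi_nelson_hom_comp (d : Order.disp_t)
    (S T U : centeredHemiNelsonType d) (g : T -> U) (f : S -> T) :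
  is_centered_hemi_nelson_hom g -> is_centered_hemi_nelson_hom f ->
  is_centered_hemi_nelson_hom (fun x => g (f x)).
Proof.
move=> [gl gn gc] [fl fn fc].
by split=> [|x|]; [exact: is_imp_lattice_hom_comp|rewrite fn gn|rewrite fc gc].
Qed.

Lemma sval_inj (T : Type) (P : T -> Prop) (u v : {x | P x}) :
  sval u = sval v -> u = v.
Proof. exact: eq_sig_hprop (fun _ => @Prop_irrelevance _) u v. Qed.

Section HIL.
Variable d : Order.disp_t.
Implicit Types A B C D : hLatticeType d.

Definition hlattice_id A : hlattice_hom A A :=
  exist _ _ (is_imp_lattice_hom_id A).

Definition hlattice_comp A B C (g : hlattice_hom B C) (f : hlattice_hom A B) :
    hlattice_hom A C :=
  exist _ _ (is_imp_lattice_hom_comp (svalP g) (svalP f)).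

Let hcompA A B C D (h : hlattice_hom C D) (g : hlattice_hom B C)
    (f : hlattice_hom A B) :
  hlattice_comp h (hlattice_comp g f) = hlattice_comp (hlattice_comp h g) f.
Proof. exact: sval_inj. Qed.

Let hcomp1m A B (f : hlattice_hom A B) : hlattice_comp (hlattice_id B) f = f.
Proof. exact: sval_inj. Qed.

Let hcompm1 A B (f : hlattice_hom A B) : hlattice_comp f (hlattice_id A) = f.
Proof. exact: sval_inj. Qed.

Definition hIL : category := Category hcompA hcomp1m hcompm1.

End HIL.

Section KHILC.
Variable d : Order.disp_t.
Implicit Types S T U V : centeredHemiNelsonType d.
Local Notation khom := (@centered_hemi_nelson_hom d).

Definition centered_hemi_nelson_id T : khom T T :=
  exist _ _ (is_centered_hemi_nelson_hom_id T).

Definition centered_hemi_nelson_comp S T U (g : khom T U) (f : khom S T) :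
    khom S U :=
  exist _ _ (is_centered_hemi_nelson_hom_comp (svalP g) (svalP f)).

Local Notation kcomp := centered_hemi_nelson_comp.

Let kcompA S T U V (h : khom U V) (g : khom T U) (f : khom S T) :
  kcomp h (kcomp g f) = kcomp (kcomp h g) f.
Proof. exact: sval_inj. Qed.

Let kcomp1m S T (f : khom S T) : kcomp (centered_hemi_nelson_id T) f = f.
Proof. exact: sval_inj. Qed.

Let kcompm1 S T (f : khom S T) : kcomp f (centered_hemi_nelson_id S) = f.
Proof. exact: sval_inj. Qed.

Definition KhILc : category := Category kcompA kcomp1m kcompm1.

End KHILC.

(* Main.v *)
Require Import Defs.
From HB Require Import structures.
From mathcomp Require Import all_boot all_order.
From mathcomp Require Import boolp.

(** An h-lattice [A] is sent to its twist algebra [{(a, b) | a /\ b = 0}] with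
    [(a, b) -> (a', b') = (a -> a', a /\ b')] and center [(0, 0)]; a centered
    hemi-Nelson algebra [T] is sent to the interval [[c, 1]].  The point is that
    the relation [x -> y = 1 = y -> x], over which (hN3)--(hN10) are stated, is
    nothing but [x \/ c = y \/ c]: (hN2) and the Kleene law give one inclusion,
    and (hN3), (hN4) at [x = y = c] say that [0] and [c] are related, so (hN9)
    gives the other.  Hence [c, 1] is closed under [->], it is an h-lattice, and
    [x |-> (x \/ c, ~x \/ c)] embeds [T] in the twist algebra of [[c, 1]];
    (CK) says precisely that this embedding is onto. *)

Set Implicit Arguments.
Unset Strict Implicit.
Unset Printing Implicit Defensive.

Import Order.TTheory.
Local Open Scope order_scope.

(* [d'] is the display of the structures put on the twist algebra. *)
Record twist (d' d : Order.disp_t) (A : hLatticeType d) := Twist {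
  twist_val : A * A;
  _ : twist_val.1 `&` twist_val.2 == \bot
}.

HB.instance Definition _ (d' d : Order.disp_t) (A : hLatticeType d) :=
  [isSub for @twist_val d' d A].
HB.instance Definition _ (d' d : Order.disp_t) (A : hLatticeType d) :=
  [Choice of twist d' A by <:].

(** * The twist algebra of an h-lattice, and (CK) for it *)

Section TwistAlgebra.
Variables (d' d : Order.disp_t) (A : hLatticeType d).
Local Notation twist := (twist d' A).
Implicit Types x y z : twist.

Definition tpos x : A := (twist_val x).1.
Definition tneg x : A := (twist_val x).2.

Lemma tpos_meet_tneg x : tpos x `&` tneg x = \bot.
Proof. by apply/eqP; case: x. Qed.

Lemma twist_inj x y : tpos x = tpos y -> tneg x = tneg y -> x = y.
Proof.
rewrite /tpos /tneg => xyp xyn; apply: val_inj => /=.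
by rewrite [LHS]surjective_pairing xyp xyn -surjective_pairing.
Qed.

Lemma twist_meet_subproof x y :
  (tpos x `&` tpos y) `&` (tneg x `|` tneg y) == \bot.
Proof.
by rewrite meetUr meetAC tpos_meet_tneg meet0x -meetA tpos_meet_tneg meetx0
  joinx0.
Qed.

Lemma twist_join_subproof x y :
  (tpos x `|` tpos y) `&` (tneg x `&` tneg y) == \bot.
Proof.
by rewrite meetUl meetA tpos_meet_tneg meet0x meetCA tpos_meet_tneg meetx0
  joinx0.
Qed.

Lemma twist_neg_subproof x : tneg x `&` tpos x == \bot.
Proof. by rewrite meetC tpos_meet_tneg. Qed.

(** The law a /\ (a -> b) <= b bounds the left side by [tpos y] /\ [tneg y], which is 0. *)
Lemma twist_imp_subproof x y :
  (tpos x `-> tpos y) `&` (tpos x `&` tneg y) == \bot.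
Proof.
rewrite -lex0 meetA -(tpos_meet_tneg y) leI2 // meetC.
exact: hlat_meet_imp.
Qed.

Lemma twist_cst_subproof (a b : A) : a = \bot \/ b = \bot -> a `&` b == \bot.
Proof. by case=> ->; rewrite (meet0x, meetx0). Qed.

Definition twist_meet x y : twist :=
  @Twist d' d A (_, _) (twist_meet_subproof x y).
Definition twist_join x y : twist :=
  @Twist d' d A (_, _) (twist_join_subproof x y).
Definition twist_neg x : twist := @Twist d' d A (_, _) (twist_neg_subproof x).
Definition twist_imp x y : twist :=
  @Twist d' d A (_, _) (twist_imp_subproof x y).
Definition twist_bot : twist :=
  @Twist d' d A (_, \top) (twist_cst_subproof (or_introl erefl)).
Definition twist_top : twist :=
  @Twist d' d A (\top, _) (twist_cst_subproof (or_intror erefl)).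
Definition twist_center : twist :=
  @Twist d' d A (_, \bot) (twist_cst_subproof (or_introl erefl)).

Fact twist_meetC : commutative twist_meet.
Proof. by move=> x y; apply: twist_inj; [exact: meetC|exact: joinC]. Qed.
Fact twist_joinC : commutative twist_join.
Proof. by move=> x y; apply: twist_inj; [exact: joinC|exact: meetC]. Qed.
Fact twist_meetA : associative twist_meet.
Proof. by move=> x y z; apply: twist_inj; [exact: meetA|exact: joinA]. Qed.
Fact twist_joinA : associative twist_join.
Proof. by move=> x y z; apply: twist_inj; [exact: joinA|exact: meetA]. Qed.
Fact twist_joinKI y x : twist_meet x (twist_join x y) = x.
Proof. by apply: twist_inj; [exact: joinKI|exact: meetKU]. Qed.
Fact twist_meetKU y x : twist_join x (twist_meet x y) = x.
Proof. by apply: twist_inj; [exact: meetKU|exact: joinKI]. Qed.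
Fact twist_meetUl : left_distributive twist_meet twist_join.
Proof. by move=> x y z; apply: twist_inj; [exact: meetUl|exact: joinIl]. Qed.
Fact twist_meetxx : idempotent_op twist_meet.
Proof. by move=> x; apply: twist_inj; [exact: meetxx|exact: joinxx]. Qed.

HB.instance Definition _ := @Order.isMeetJoinDistrLattice.Build d' twist
  (fun x y => twist_meet x y == x)
  (fun x y => (y != x) && (twist_meet x y == x))
  twist_meet twist_join (fun _ _ => erefl) (fun _ _ => erefl)
  twist_meetC twist_joinC twist_meetA twist_joinA twist_joinKI twist_meetKU
  twist_meetUl twist_meetxx.

Fact twist_le0x x : twist_bot <= x.
Proof. by apply/eqP/twist_inj; [exact: meet0x|exact: join1x]. Qed.
Fact twist_lex1 x : x <= twist_top.
Proof. by apply/eqP/twist_inj; [exact: meetx1|exact: joinx0]. Qed.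

HB.instance Definition _ := Order.hasBottom.Build d' twist twist_le0x.
HB.instance Definition _ := Order.hasTop.Build d' twist twist_lex1.
HB.instance Definition _ := hasImp.Build d' twist twist_imp.

Lemma tposI x y : tpos (x `&` y) = tpos x `&` tpos y. Proof. by []. Qed.
Lemma tnegI x y : tneg (x `&` y) = tneg x `|` tneg y. Proof. by []. Qed.
Lemma tposU x y : tpos (x `|` y) = tpos x `|` tpos y. Proof. by []. Qed.
Lemma tnegU x y : tneg (x `|` y) = tneg x `&` tneg y. Proof. by []. Qed.
Lemma tpos_imp x y : tpos (x `-> y) = tpos x `-> tpos y. Proof. by []. Qed.
Lemma tneg_imp x y : tneg (x `-> y) = tpos x `&` tneg y. Proof. by []. Qed.

(** The order comes from the meet, which joins the second components; hence the reversal there. *)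
Lemma twist_leE x y : (x <= y) = (tpos x <= tpos y) && (tneg y <= tneg x).
Proof.
apply/eqP/andP => [xy|[xyp xyn]].
  by split; [apply/meet_idPl/(congr1 tpos xy)|apply/join_idPl/(congr1 tneg xy)].
by apply: twist_inj; [exact/meet_idPl|exact/join_idPl].
Qed.

Fact twist_negK x : twist_neg (twist_neg x) = x.
Proof. exact: twist_inj. Qed.
Fact twist_neg_meet x y : twist_neg (x `&` y) = twist_neg x `|` twist_neg y.
Proof. exact: twist_inj. Qed.
Fact twist_kleene x y :
  (x `&` twist_neg x) `&` (y `|` twist_neg y) = x `&` twist_neg x.
Proof.
apply: twist_inj; rewrite ?tposI ?tnegI ?tposU ?tnegU /=.
  by rewrite tpos_meet_tneg meet0x.
by rewrite [tneg y `&` _]meetC tpos_meet_tneg joinx0.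
Qed.

HB.instance Definition _ := TBDistrLattice_isKleene.Build d' twist
  twist_negK twist_neg_meet twist_kleene.

Lemma tpos_neg x : tpos (sneg x) = tneg x. Proof. by []. Qed.
Lemma tneg_neg x : tneg (sneg x) = tpos x. Proof. by []. Qed.

(** Together with its converse [imp_eq1_tpos], this reduces (hN1) and (hN3)--(hN10) to equalities of
    first components. *)
Lemma twist_imp_eq1 x y : tpos x = tpos y -> x `-> y = \top.
Proof.
move=> xy; apply: twist_inj; first by rewrite tpos_imp xy hlat_impxx.
by rewrite tneg_imp xy tpos_meet_tneg.
Qed.

Lemma imp_eq1_tpos_le x y : x `-> y = \top -> tpos x <= tpos y.
Proof.
move=> /(congr1 tpos); rewrite tpos_imp => xy.
by have := hlat_meet_imp (tpos x) (tpos y); rewrite xy meetx1.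
Qed.

Lemma imp_eq1_tpos x y : x `-> y = \top -> y `-> x = \top -> tpos x = tpos y.
Proof.
by move=> /imp_eq1_tpos_le xy /imp_eq1_tpos_le yx; apply/le_anti/andP.
Qed.

Fact twist_hN2 x y : x `&` (x `-> y) <= x `&` (sneg x `|` y).
Proof.
rewrite twist_leE ?tposI ?tnegI ?tposU ?tnegU ?tpos_imp ?tneg_imp ?tneg_neg.
(* The second components of both sides are [tneg x] \/ ([tpos x] /\ [tneg y]), so only the first
   ones need an argument. *)
rewrite lexx andbT lexI leIl /= tpos_neg.
exact: le_trans (hlat_meet_imp _ _) (leUr _ _).
Qed.
Fact twist_hN56 x y :
  tpos (x `&` y `&` (x `-> y)) = tpos (x `&` (x `-> y)).
Proof.
rewrite !tposI tpos_imp meetAC.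
by apply/meet_idPl/hlat_meet_imp.
Qed.
Fact twist_hN7 x y z :
  x `-> y = \top -> y `-> x = \top -> y `-> z = \top -> z `-> y = \top ->
  x `-> z = \top /\ z `-> x = \top.
Proof.
move=> xy yx yz zy; have e := imp_eq1_tpos xy yx; have e' := imp_eq1_tpos yz zy.
by split; apply: twist_imp_eq1; rewrite e e'.
Qed.
Fact twist_hN8 x y z : x `-> y = \top -> y `-> x = \top ->
  (x `&` z) `-> (y `&` z) = \top.
Proof.
by move=> xy yx; apply: twist_imp_eq1; rewrite !tposI (imp_eq1_tpos xy yx).
Qed.
Fact twist_hN9 x y z : x `-> y = \top -> y `-> x = \top ->
  (x `|` z) `-> (y `|` z) = \top.
Proof.
by move=> xy yx; apply: twist_imp_eq1; rewrite !tposU (imp_eq1_tpos xy yx).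
Qed.
Fact twist_hN10 x y z : x `-> y = \top -> y `-> x = \top ->
  (x `-> z) `-> (y `-> z) = \top /\ (z `-> x) `-> (z `-> y) = \top.
Proof.
by move=> xy yx; split; apply: twist_imp_eq1;
  rewrite !tpos_imp (imp_eq1_tpos xy yx).
Qed.

(** (hN3) and (hN4) hold by computation: the two elements compared have the same first component
    [tpos x] /\ [tneg y]. *)
HB.instance Definition _ := KleeneAlg_isHemiNelson.Build d' twist
  (fun x => twist_imp_eq1 erefl) twist_hN2
  (fun x y => @twist_imp_eq1 (sneg (x `-> y)) (x `&` sneg y) erefl)
  (fun x y => @twist_imp_eq1 (x `&` sneg y) (sneg (x `-> y)) erefl)
  (fun x y => twist_imp_eq1 (twist_hN56 x y))
  (fun x y => twist_imp_eq1 (esym (twist_hN56 x y)))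
  twist_hN7 twist_hN8 twist_hN9 twist_hN10.

Fact twist_neg_center : sneg twist_center = twist_center.
Proof. exact: twist_inj. Qed.

HB.instance Definition _ :=
  HemiNelson_isCentered.Build d' twist twist_neg_center.

Lemma center_le_twist x : (center <= x) = (tneg x == \bot).
Proof. by rewrite twist_leE le0x lex0. Qed.

Lemma twist_CK : CK twist.
Proof.
move=> x y; rewrite !center_le_twist twist_leE lex0.
move=> /eqP xn /eqP yn /andP[/eqP xy _].
have xyP : tpos x `&` tpos y == \bot by exact/eqP.
(* Here x = (a, 0) and y = (b, 0), and x /\ y <= c amounts to a /\ b = 0, so (a, b) is itself an
   element of the twist algebra. *)
exists (@Twist d' d A (_, _) xyP).
by split; apply: twist_inj; rewrite ?tposU ?tnegU /= ?joinx0 // meetx0.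
Qed.

End TwistAlgebra.

(** * Functoriality of the twist construction *)

Section TwistFunctor.
Variables d d' : Order.disp_t.

Section Map.
Variables (A B : hLatticeType d) (f : hlattice_hom A B).

Lemma twist_map_subproof (x : twist d' A) :
  sval f (tpos x) `&` sval f (tneg x) == \bot.
Proof.
by case: (svalP f) => fI _ _ f0 _; rewrite -fI tpos_meet_tneg f0.
Qed.

Definition twist_map (x : twist d' A) : twist d' B :=
  @Twist d' d B (_, _) (twist_map_subproof x).

Lemma twist_map_hom : is_centered_hemi_nelson_hom twist_map.
Proof.
case: (svalP f) => fI fU fi f0 f1.
by split=> [|x|]; [split=> [x y|x y|x y||]| |]; apply: twist_inj;
  rewrite // /tpos /tneg /= ?(fI, fU, fi, f0, f1).
Qed.

End Map.

Definition twist_obj (A : hIL d) : @full_subcategory (KhILc d') (@CK d') :=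
  exist (@CK d') (twist d' A : centeredHemiNelsonType d') (@twist_CK d' d A).

Definition twist_hom (A B : hIL d) (f : hom A B) :
    hom (twist_obj A) (twist_obj B) :=
  exist _ _ (twist_map_hom f).

Lemma twist_hom1 (A : hIL d) : twist_hom (idm A) = idm (twist_obj A).
Proof. by apply: sval_inj; apply/funext => x; apply: twist_inj. Qed.

Lemma twist_homM (A B C : hIL d) (g : hom B C) (f : hom A B) :
  twist_hom (compm g f) = compm (twist_hom g) (twist_hom f).
Proof. by apply: sval_inj; apply/funext => x; apply: twist_inj. Qed.

Definition twist_functor :
    functor (hIL d) (@full_subcategory (KhILc d') (@CK d')) :=
  Functor twist_hom1 twist_homM.

End TwistFunctor.

(** * Arithmetic around the center of a centered hemi-Nelson algebra *)

Section CenteredHemiNelsonTheory.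
Variables (d : Order.disp_t) (T : centeredHemiNelsonType d).
Implicit Types x y z : T.
Local Notation c := (center : T).

Lemma sneg_join x y : sneg (x `|` y) = sneg x `&` sneg y.
Proof. by rewrite -[RHS]snegK sneg_meet !snegK. Qed.

Lemma sneg_le x y : (sneg x <= sneg y) = (y <= x).
Proof.
have h u v : u <= v -> sneg v <= sneg u.
  by move=> /meet_idPl <-; rewrite sneg_meet leUr.
by apply/idP/idP => [/h|/h //]; rewrite !snegK.
Qed.

Lemma sneg0 : sneg \bot = \top :> T.
Proof. by apply/eqP; rewrite -le1x -[\top]snegK sneg_le le0x. Qed.

Lemma sneg1 : sneg \top = \bot :> T.
Proof. by rewrite -sneg0 snegK. Qed.

(** This is the Kleene law at y = c, where c \/ ~c = c. *)
Lemma meet_sneg_le_center x : x `&` sneg x <= c.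
Proof. by rewrite -(kleene_law x c) sneg_center joinxx leIr. Qed.

(** By (hN2), x <= (x /\ ~x) \/ (x /\ y); the first term is below c and the second below y. *)
Lemma imp_eq1_joinc_le x y : x `-> y = \top -> x `|` c <= y `|` c.
Proof.
move=> xy; rewrite leUx leUr andbT.
have := hN2 x y; rewrite xy meetx1 => /le_trans; apply.
rewrite meetUr leUx (le_trans (meet_sneg_le_center x)) ?leUr //=.
by rewrite (le_trans (leIr _ _)) ?leUl.
Qed.

Lemma imp_eq1_joinc x y :
  x `-> y = \top -> y `-> x = \top -> x `|` c = y `|` c.
Proof.
by move=> xy yx; apply/le_anti/andP; split; apply: imp_eq1_joinc_le.
Qed.

Lemma imp_bot_center : \bot `-> c = \top.
Proof. by have := hN3 c c; rewrite hN1 sneg1 sneg_center meetxx. Qed.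

Lemma imp_center_bot : c `-> \bot = \top.
Proof. by have := hN4 c c; rewrite hN1 sneg1 sneg_center meetxx. Qed.

Lemma imp_joinc x : x `-> (x `|` c) = \top.
Proof.
by have := hN9 _ _ x imp_bot_center imp_center_bot; rewrite join0x joinC.
Qed.

Lemma joinc_imp x : (x `|` c) `-> x = \top.
Proof.
by have := hN9 _ _ x imp_center_bot imp_bot_center; rewrite join0x joinC.
Qed.

Lemma sneg_imp_joinc x y : sneg (x `-> y) `|` c = (x `&` sneg y) `|` c.
Proof. by apply: imp_eq1_joinc; [exact: hN3|exact: hN4]. Qed.

(** Negation turns the goal into ~(x -> y) <= c. By [sneg_imp_joinc] this reduces to x /\ ~y <= c,
    and ~y <= ~c = c. *)
Lemma center_le_imp x y : c <= y -> c <= x `-> y.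
Proof.
move=> cy; rewrite -sneg_le sneg_center; apply/join_idPr.
rewrite sneg_imp_joinc; apply/join_idPr/(le_trans (leIr _ _)).
by rewrite -sneg_center sneg_le.
Qed.

(** (hN6) bounds the left side by (x /\ y /\ (x -> y)) \/ c, and both terms lie below y. This is the
    h-lattice law on [c, 1]. *)
Lemma meet_imp_le x y : c <= y -> x `&` (x `-> y) <= y.
Proof.
move=> cy; have /(le_trans (leUl _ c)) := imp_eq1_joinc_le (hN6 x y).
move=> /le_trans; apply; rewrite leUx cy andbT.
by rewrite (le_trans (leIl _ _)) ?leIr.
Qed.

Lemma imp_joinc_joinc x y : (x `-> y) `|` c = (x `|` c) `-> (y `|` c).
Proof.
(* The right side already lies above c, so both sides can be compared after joining with c; (hN10)
   then replaces x by x \/ c and y by y \/ c, each replacement requiring implications both ways. *)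
rewrite -[RHS](join_l (center_le_imp _ (leUr c y))).
have [xl _] := hN10 _ _ y (imp_joinc x) (joinc_imp x).
have [xr _] := hN10 _ _ y (joinc_imp x) (imp_joinc x).
have [_ yl] := hN10 _ _ (x `|` c) (imp_joinc y) (joinc_imp y).
have [_ yr] := hN10 _ _ (x `|` c) (joinc_imp y) (imp_joinc y).
by rewrite (imp_eq1_joinc xl xr) (imp_eq1_joinc yl yr).
Qed.

(** Since ~(~x \/ c) = x /\ c, the second hypothesis fixes the meet with c while the first fixes the
    join. *)
Lemma joinc_sneg_inj x y :
  x `|` c = y `|` c -> sneg x `|` c = sneg y `|` c -> x = y.
Proof.
move=> xyU xyS; have xyI : x `&` c = y `&` c.
  have := congr1 (@sneg d T) xyS.
  by rewrite !sneg_join !snegK sneg_center.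
(* An element of a distributive lattice is determined by its meet and join
   with [c]. *)
have h u v : u `|` c = v `|` c -> u `&` c = v `&` c -> u <= v.
  move=> uvU uvI; rewrite -[u](joinKI c) uvU meetUr uvI leUx.
  by rewrite leIr leIl.
by apply/le_anti/andP; split; apply: h.
Qed.

End CenteredHemiNelsonTheory.

(* [d'] is the display of the structures put on the interval. *)
Record positive (d' d : Order.disp_t) (T : centeredHemiNelsonType d) :=
  Positive { pval : T; _ : center <= pval }.

HB.instance Definition _ (d' d : Order.disp_t) (T : centeredHemiNelsonType d) :=
  [isSub for @pval d' d T].
HB.instance Definition _ (d' d : Order.disp_t) (T : centeredHemiNelsonType d) :=
  [Choice of positive d' T by <:].

(** * The h-lattice structure on the interval [c, 1] *)

Section PositiveAlgebra.
Variables (d' d : Order.disp_t) (T : centeredHemiNelsonType d).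
Local Notation positive := (positive d' T).
Implicit Types u v w : positive.

Lemma pvalP u : center <= pval u. Proof. by case: u. Qed.

Lemma pval_inj u v : pval u = pval v -> u = v.
Proof. exact: val_inj. Qed.

Lemma positive_meet_subproof u v : center <= pval u `&` pval v.
Proof. by rewrite lexI !pvalP. Qed.

Lemma positive_join_subproof u v : center <= pval u `|` pval v.
Proof. by rewrite lexU2 // pvalP. Qed.

Lemma positive_imp_subproof u v : center <= pval u `-> pval v.
Proof. exact/center_le_imp/pvalP. Qed.

Definition positive_meet u v : positive :=
  Positive d' (positive_meet_subproof u v).
Definition positive_join u v : positive :=
  Positive d' (positive_join_subproof u v).
Definition positive_imp u v : positive :=
  Positive d' (positive_imp_subproof u v).
Definition positive_bot : positive := Positive d' (lexx (center : T)).
Definition positive_top : positive := Positive d' (lex1 (center : T)).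

Fact positive_meetC : commutative positive_meet.
Proof. by move=> u v; apply/pval_inj/meetC. Qed.
Fact positive_joinC : commutative positive_join.
Proof. by move=> u v; apply/pval_inj/joinC. Qed.
Fact positive_meetA : associative positive_meet.
Proof. by move=> u v w; apply/pval_inj/meetA. Qed.
Fact positive_joinA : associative positive_join.
Proof. by move=> u v w; apply/pval_inj/joinA. Qed.
Fact positive_joinKI v u : positive_meet u (positive_join u v) = u.
Proof. exact/pval_inj/joinKI. Qed.
Fact positive_meetKU v u : positive_join u (positive_meet u v) = u.
Proof. exact/pval_inj/meetKU. Qed.
Fact positive_meetUl : left_distributive positive_meet positive_join.
Proof. by move=> u v w; apply/pval_inj/meetUl. Qed.
Fact positive_meetxx : idempotent_op positive_meet.
Proof. by move=> u; apply/pval_inj/meetxx. Qed.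

HB.instance Definition _ := @Order.isMeetJoinDistrLattice.Build d' positive
  (fun u v => positive_meet u v == u)
  (fun u v => (v != u) && (positive_meet u v == u))
  positive_meet positive_join (fun _ _ => erefl) (fun _ _ => erefl)
  positive_meetC positive_joinC positive_meetA positive_joinA
  positive_joinKI positive_meetKU positive_meetUl positive_meetxx.

Lemma positive_leE u v : (u <= v) = (pval u <= pval v).
Proof. by rewrite leEmeet [RHS]leEmeet. Qed.

Fact positive_le0x u : positive_bot <= u.
Proof. by rewrite positive_leE pvalP. Qed.
Fact positive_lex1 u : u <= positive_top.
Proof. by rewrite positive_leE lex1. Qed.

HB.instance Definition _ := Order.hasBottom.Build d' positive positive_le0x.
HB.instance Definition _ := Order.hasTop.Build d' positive positive_lex1.
HB.instance Definition _ := hasImp.Build d' positive positive_imp.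

Fact positive_impxx u : u `-> u = \top.
Proof. exact/pval_inj/hN1. Qed.
Fact positive_meet_imp u v : u `&` (u `-> v) <= v.
Proof. by rewrite positive_leE meet_imp_le ?pvalP. Qed.

HB.instance Definition _ := ImpLattice_isHLattice.Build d' positive
  positive_impxx positive_meet_imp.

End PositiveAlgebra.

(** * Functoriality of the interval construction *)

Section PositiveFunctor.
Variables d d' : Order.disp_t.

Section Map.
Variables (S T : centeredHemiNelsonType d') (f : centered_hemi_nelson_hom S T).

Lemma positive_map_subproof (u : positive d S) : center <= sval f (pval u).
Proof.
case: (svalP f) => [[fI _ _ _ _] _ fc].
by rewrite leEmeet -{1}fc -fI (meet_idPl (pvalP u)) fc.
Qed.

Definition positive_map (u : positive d S) : positive d T :=
  Positive d (positive_map_subproof u).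

Lemma positive_map_hom : is_imp_lattice_hom positive_map.
Proof.
case: (svalP f) => [[fI fU fi f0 f1] _ fc].
split=> [x y|x y|x y||]; apply: pval_inj;
  [exact: fI|exact: fU|exact: fi|exact: fc|exact: f1].
Qed.

End Map.

Local Notation KhILcCK := (@full_subcategory (KhILc d') (@CK d')).

Definition positive_obj (T : KhILcCK) : hIL d := positive d (sval T).

Definition positive_hom (S T : KhILcCK) (f : hom S T) :
    hom (positive_obj S) (positive_obj T) :=
  exist _ _ (positive_map_hom f).

Lemma positive_hom1 (T : KhILcCK) : positive_hom (idm T) = idm (positive_obj T).
Proof. by apply: sval_inj; apply/funext => u; apply: pval_inj. Qed.

Lemma positive_homM (S T U : KhILcCK) (g : hom T U) (f : hom S T) :
  positive_hom (compm g f) = compm (positive_hom g) (positive_hom f).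
Proof. by apply: sval_inj; apply/funext => u; apply: pval_inj. Qed.

Definition positive_functor : functor KhILcCK (hIL d) :=
  Functor positive_hom1 positive_homM.

End PositiveFunctor.

(** * An h-lattice recovered from its twist algebra *)

Section PositiveTwist.
Variables (d d' : Order.disp_t) (A : hLatticeType d).
Local Notation PK := (positive d (twist d' A)).

Definition positive_twist_pos (u : PK) : A := tpos (pval u).

Lemma twist_of_subproof (a : A) : a `&` \bot == \bot.
Proof. by rewrite meetx0. Qed.

Lemma positive_twist_of_subproof (a : A) :
  center <= @Twist d' d A (a, \bot) (twist_of_subproof a).
Proof. by rewrite center_le_twist. Qed.

Definition positive_twist_of (a : A) : PK :=
  Positive d (positive_twist_of_subproof a).

(** The elements above the center are exactly the pairs (a, 0), so the first component determines
    them. *)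
Lemma positive_twist_posK : cancel positive_twist_pos positive_twist_of.
Proof.
move=> u; apply: pval_inj; apply: twist_inj => //=.
by apply/esym/eqP; rewrite -center_le_twist pvalP.
Qed.

(** All by computation: first components are combined as in [A], and the bottom of the interval is
    the center (0, 0). *)
Lemma positive_twist_pos_hom : is_imp_lattice_hom positive_twist_pos.
Proof. by []. Qed.

End PositiveTwist.

(** * The embedding of T in the twist algebra of [c, 1] *)

Section TwistPositive.
Variables (d d' : Order.disp_t) (T : centeredHemiNelsonType d').
Local Notation KP := (twist d' (positive d T)).

Definition joinc (x : T) : positive d T := Positive d (leUr center x).

Lemma twist_joinc_subproof (x : T) : joinc x `&` joinc (sneg x) == \bot.
Proof.
apply/eqP; apply: pval_inj; rewrite /= -joinIl.
exact/join_idPr/meet_sneg_le_center.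
Qed.

Definition twist_joinc (x : T) : KP :=
  @Twist d' d _ (_, _) (twist_joinc_subproof x).

Lemma twist_joinc_hom : is_centered_hemi_nelson_hom twist_joinc.
Proof.
split=> [|x|]; [split=> [x y|x y|x y||]| |]; apply: twist_inj;
  apply: pval_inj; rewrite /= ?sneg_meet ?sneg_join ?snegK ?sneg_center
    ?sneg0 ?sneg1 ?joinxx ?join0x ?join1x -?joinIl //.
(* What remains is the second component for meets, the first for joins, and both for implication. *)
- by rewrite joinACA joinxx.
- by rewrite joinACA joinxx.
- exact: imp_joinc_joinc.
- exact: sneg_imp_joinc.
Qed.

Lemma twist_joinc_inj : injective twist_joinc.
Proof.
move=> x y xy; apply: joinc_sneg_inj.
  exact: (congr1 (fun t => pval (tpos t)) xy).
exact: (congr1 (fun t => pval (tneg t)) xy).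
Qed.

(** The bottom of [c, 1] is c, so disjointness of the two components of [t] is the hypothesis x /\ y
    <= c of (CK), whose witness is the preimage. *)
Lemma twist_joinc_surj : CK T -> forall t : KP, exists x, twist_joinc x = t.
Proof.
move=> ck t; have := ck _ _ (pvalP (tpos t)) (pvalP (tneg t)).
have /(congr1 (@pval _ _ _)) /= e := tpos_meet_tneg t.
rewrite e lexx => /(_ isT)[x [xp xn]].
by exists x; apply: twist_inj; apply: pval_inj.
Qed.

End TwistPositive.

(** With this, an isomorphism needs the homomorphism laws checked in one direction only. *)
Lemma can_imp_lattice_hom (d : Order.disp_t) (A B : impLatticeType d)
    (f : A -> B) (g : B -> A) :
  cancel f g -> cancel g f -> is_imp_lattice_hom f -> is_imp_lattice_hom g.
Proof.
move=> fK gK [fI fU fi f0 f1].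
by split=> [x y|x y|x y||]; apply: (can_inj fK);
  rewrite ?(fI, fU, fi, f0, f1) !gK.
Qed.

Lemma can_centered_hemi_nelson_hom (d : Order.disp_t)
    (S T : centeredHemiNelsonType d) (f : S -> T) (g : T -> S) :
  cancel f g -> cancel g f ->
  is_centered_hemi_nelson_hom f -> is_centered_hemi_nelson_hom g.
Proof.
move=> fK gK [fl fn fc]; split; first exact: can_imp_lattice_hom fl.
  by move=> x; apply: (can_inj fK); rewrite fn !gK.
by apply: (can_inj fK); rewrite fc gK.
Qed.

(** * The two natural isomorphisms and the equivalence *)

Section Equivalence.
Variables d d' : Order.disp_t.
Local Notation K := (twist_functor d d').
Local Notation P := (positive_functor d d').

Lemma positive_twist_iso :
  inhabited (natural_iso (functor_comp P K) (functor_id (hIL d))).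
Proof.
pose posH (A : hIL d) : hom (P (K A)) A :=
  exist _ _ (@positive_twist_pos_hom d d' A).
have ofK (A : hIL d) :
  cancel (@positive_twist_of d d' A) (@positive_twist_pos d d' A) by [].
pose ofH (A : hIL d) : hom A (P (K A)) := exist _ _
  (can_imp_lattice_hom (@positive_twist_posK d d' A) (ofK A) (svalP (posH A))).
constructor; apply: (@NaturalIso _ _ (functor_comp P K) (functor_id _)
  posH ofH) => [A|A|A B f]; apply: sval_inj; apply/funext => //=.
exact: positive_twist_posK.
Qed.

Lemma twist_positive_iso :
  inhabited (natural_iso (functor_comp K P)
    (functor_id (@full_subcategory (KhILc d') (@CK d')))).
Proof.
pose C := @full_subcategory (KhILc d') (@CK d').
(* (CK) yields mere existence, so the preimage is picked by choice; injectivity makes it unique. *)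
pose inv (T : C) t := sval (cid (@twist_joinc_surj d d' _ (svalP T) t)).
have invK (T : C) : cancel (inv T) (@twist_joinc d d' (sval T)).
  by move=> t; rewrite /inv; case: cid.
have joincK (T : C) : cancel (@twist_joinc d d' (sval T)) (inv T).
  by move=> x; apply: (@twist_joinc_inj d); rewrite invK.
pose joincH (T : C) : hom T (K (P T)) :=
  exist _ _ (@twist_joinc_hom d d' (sval T)).
pose invH (T : C) : hom (K (P T)) T := exist _ _
  (can_centered_hemi_nelson_hom (joincK T) (invK T) (svalP (joincH T))).
constructor; apply: (@NaturalIso _ _ (functor_comp K P) (functor_id C)
  invH joincH) => [T|T|S T f]; apply: sval_inj; apply/funext => t /=.
- exact: invK.
- exact: joincK.
(* Naturality of the chosen inverse is transported to that of [twist_joinc], which says f(x \/ c) =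
   f(x) \/ c and f(~x \/ c) = ~f(x) \/ c. *)
apply: (@twist_joinc_inj d); rewrite invK -{1}[t]invK.
case: (svalP f) => [[_ fU _ _ _] fn fc].
by apply: twist_inj; apply: pval_inj; rewrite /= fU fc ?fn.
Qed.

End Equivalence.

Theorem theorem38 (d d' : Order.disp_t) :
  equivalent_categories (hIL d) (@full_subcategory (KhILc d') (@CK d')).
Proof.
exists (twist_functor d d'), (positive_functor d d'); split.
  exact: positive_twist_iso.
exact: twist_positive_iso.
Qed.
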